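(* Fix $0 < \alpha \le 1$ and $\epsilon > 0$. Let $f:\mathbb N \to \mathbb Z$ be an $\alpha$-primary pseudo-polynomial such that $$|f(n)| = O\left(e^{(2/3 - \epsilon)\alpha n}\right) \quad (n \to \infty).$$ Then $f$ is a polynomial, i.e. there is a polynomial $P \in \mathbb Q[X]$ with $f(n) = P(n)$ for all $n \in \mathbb N$.
   Context: Here $\mathbb N = \{0,1,2,\dots\}$. Let $0<\alpha\le 1$. A function $f:\mathbb N \to \mathbb Z$ is an $\alpha$-primary pseudo-polynomial if there is a set of primes $\mathcal P$ with $$\prod_{p \in \mathcal P,\ p \le j} p = e^{\alpha j + o(j)} \quad (j \to \infty)$$ such that for all $p \in \mathcal P$ and all $n \in \mathbb N$, $f(n+p) \equiv f(n) \pmod p$. *)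

(* Defs.v *)
From HB Require Import structures.
From mathcomp Require Import all_boot all_order all_algebra.
From mathcomp Require Import all_classical all_reals all_analysis.

Set Implicit Arguments.
Unset Strict Implicit.
Unset Printing Implicit Defensive.

Import Order.TTheory GRing.Theory Num.Theory.
Import numFieldNormedType.Exports.

Local Open Scope classical_set_scope.
Local Open Scope ring_scope.

Definition prime_prod (P : set nat) (j : nat) : nat :=
  (\prod_(0 <= p < j.+1 | p \in P) p)%N.

(* [u] is the o(j) term of the exponent.  Requiring the identity for every j,
   rather than for large j, loses nothing: the products are positive and a
   little-o near infinity is unconstrained on any initial segment. *)
Definition prod_asymptotic (R : realType) (alpha : R) (P : set nat) : Prop :=
  exists u : nat -> R,
    u =o_\oo (fun j : nat => j%:R : R) /\
    forall j : nat, (prime_prod P j)%:R = expR (alpha * j%:R + u j).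

Definition primary_pseudo_polynomial (R : realType) (alpha : R)
    (f : nat -> int) : Prop :=
  exists P : set nat,
    [/\ P `<=` [set p | prime p],
        prod_asymptotic alpha P &
        forall p, P p -> forall n : nat, (f (n + p)%N = f n %[mod p])%Z].

(* Main.v *)
Require Import Defs.
From HB Require Import structures.
From mathcomp Require Import all_boot all_order all_algebra.
From mathcomp Require Import all_classical all_reals all_analysis.
From mathcomp Require Import ring lra zify.

Set Implicit Arguments.
Unset Strict Implicit.
Unset Printing Implicit Defensive.

Import Order.TTheory GRing.Theory Num.Theory.
Import numFieldNormedType.Exports.

Local Open Scope classical_set_scope.
Local Open Scope ring_scope.

(** Let [umbra f] be the linear functional on Z[X] sending ['X^n] to [f n], and
    put t = X - 1.  The values of [umbra f] at the powers of t are the Newton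
    differences of [f] at 0, so [f] is a polynomial as soon as they vanish from
    some rank on ([finite_newton_poly]).  Since t^p = X^p - 1 modulo p, the
    period p of [f] modulo p says exactly that p divides [umbra f (t^p q)] for
    every q ([umbra_period]).

    A first order relation.  Consider the integer combinations g of the
    sequences n^k f(n+j), with k < L and j < K.  They inherit the periods of
    [f], so if g vanishes below m then g(m) is a multiple of the product of the
    primes of P up to m, about e^(am) with a for alpha.  Hence each value of g
    is determined modulo e^(am) by the previous ones.  If |f(n)| is about
    e^(cn), let the coefficient of n^k f(n+j) range over [0, e^(c(K-j))]: this
    gives e^(L c K^2/2) combinations, while their values number only about
    prod_m max(1, e^(cK-(a-c)m)) = e^(c^2 K^2/(2(a-c))).  For
    c (1 + 1/L) < a the former wins, two combinations agree everywhere, and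
    their difference is a nontrivial relation ([integer_relation_of_growth]).
    L = 2 is the case c < 2a/3 of the theorem; it yields polynomials U, W, not
    both zero, such that [umbra f] kills U q + W q' for every q.

    From the relation to a polynomial.  Multiplying by t and, if needed,
    replacing [f] by its difference, one reaches W(1) = 0 and
    (U(1), W'(1)) <> (0, 0).  What decides is the p-curvature of the operator
    q |-> U q + W q', given up to a power of W by [twists U W p 1] modulo p.

    If it vanishes for infinitely many p in P, let d be the degree of [f] modulo
    such a p.  Reading the relation modulo p gives U(1) + d W'(1) = 0 modulo p,
    and the vanishing of the p-curvature improves this to a congruence modulo
    p^2.  As d < p, for large p it is an equality, which bounds d independently
    of p: the Newton differences beyond that bound are divisible by infinitely
    many primes ([zero_curvature]).

    Otherwise it is nonzero for all large p in P.  The relation always forces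
    k! to divide [umbra f] on the multiples of [twists U W k 1].  The degree of
    this polynomial is at most ke, for a bound e on the degrees of U and W, and a
    nonzero p-curvature keeps it nonzero modulo p when k is a multiple of p.
    Thus a combination of the f(n+j) that vanishes below m is at m a multiple of
    p^(m/(pe)) ([annihilator_dvd]).  The product of these powers over p in P
    grows faster than every exponential, because the harmonic series diverges,
    and the counting argument with L = 1 now shows that [f] is linearly
    recurrent.  A recurrent sequence with the periods of [f] is a polynomial
    ([recurrent_finite_newton]). *)

(** * Iterated first order operators and the p-curvature *)
Section Twist.
Variable R : comNzRingType.
Implicit Types U W a b q : {poly R}.

(** Conjugate by W^j of the operator b |-> U b + W b'.  With D = d/dX + U/W,
    [twists U W k b] is W D^k (W^(k-1) b), a denominator-free k-th iterate. *)
Definition twist U W (j : nat) b := (U + W^`() *+ j) * b + W * b^`().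

Fixpoint twists U W (k : nat) b :=
  if k is j.+1 then twists U W j (twist U W j b) else b.

Lemma twistD U W j : {morph twist U W j : a b / a + b}.
Proof. by move=> a b; rewrite /twist derivD; ring. Qed.

Lemma twistsD U W k : {morph twists U W k : a b / a + b}.
Proof. by elim: k => [|k IH] a b //=; rewrite twistD IH. Qed.

Lemma twistM U W j a b : twist U W j (a * b) = a * twist U W j b + a^`() * (W * b).
Proof. by rewrite /twist derivM; ring. Qed.

Lemma twist_mulW U W i j b : W ^+ i * twist U W (i + j) b = twist U W j (W ^+ i * b).
Proof.
elim: i j => [|i IH] j; first by rewrite !expr0 !mul1r.
rewrite exprS -mulrA addSnnS IH -[in RHS]mulrA.
by rewrite /twist ![(W * _)^`()]derivM mulrS; ring.
Qed.

(** Leibniz's rule for the k-th power of D = d/dX + U/W. *)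
Lemma twistsM U W k a b :
  twists U W k (a * b) =
  \sum_(j < k.+1) (a^`(j) * twists U W (k - j) (W ^+ j * b)) *+ 'C(k, j).
Proof.
elim: k a b => [|k IH] a b /=.
  by rewrite big_ord1 /= expr0 mul1r.
rewrite twistM twistsD !IH.
rewrite [in RHS]big_ord_recl [X in X + _ = _]big_ord_recl /=.
rewrite !bin0 !subn0 !expr0 !mul1r !mulr1n /=.
rewrite -addrA; congr (_ + _).
rewrite [in RHS](eq_bigr (fun i : 'I_k.+1 =>
    (a^`(i.+1) * twists U W (k - i) (W ^+ i.+1 * b)) *+ 'C(k, i.+1) +
    (a^`(i.+1) * twists U W (k - i) (W ^+ i.+1 * b)) *+ 'C(k, i))); last first.
  by move=> i _; rewrite /bump /= add1n binS mulrnDr subSS.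
rewrite big_split /=; congr (_ + _); last first.
  apply: eq_bigr => i _; rewrite -[a^`()^`(i)]derivSn; congr (_ * twists _ _ _ _ *+ _).
  by rewrite exprS mulrCA mulrA.
rewrite [RHS]big_ord_recr /= bin_small // mulr0n addr0.
apply: eq_bigr => i _; rewrite /bump /= add1n.
have -> : (k - i = (k - i.+1).+1)%N by have := ltn_ord i; lia.
rewrite /= -twist_mulW.
by have -> : (i.+1 + (k - i.+1) = k)%N by have := ltn_ord i; lia.
Qed.

Lemma size_twist U W e j b :
  (size U <= e.+1)%N -> (size W <= e.+1)%N -> (size (twist U W j b) <= size b + e)%N.
Proof.
move=> hU hW.
have hd (q : {poly R}) : (size q^`() <= size q)%N.
  by apply: leq_trans (size_poly _ _) _; exact: leq_pred.
have hUW : (size (U + W^`() *+ j)%R <= e.+1)%N.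
  apply: leq_trans (size_polyD _ _) _; rewrite geq_max hU /=.
  rewrite -mulr_natl -polyC_natr mul_polyC.
  by apply: leq_trans (size_scale_leq _ _) _; apply: leq_trans hW.
apply: leq_trans (size_polyD _ _) _; rewrite geq_max; apply/andP; split.
  by apply: leq_trans (size_polyMleq _ _) _; rewrite -!subn1; lia.
by apply: leq_trans (size_polyMleq _ _) _; have := hd b; rewrite -!subn1; lia.
Qed.

Lemma size_twists U W e k b :
  (size U <= e.+1)%N -> (size W <= e.+1)%N ->
  (size (twists U W k b) <= size b + k * e)%N.
Proof.
move=> hU hW; elim: k b => [|k IH] b /=; first by rewrite addn0.
by apply: leq_trans (IH _) _; rewrite mulSn addnA leq_add2r size_twist.
Qed.

End Twist.

Lemma map_twists (R S : comNzRingType) (h : {rmorphism R -> S}) (U W : {poly R}) k b :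
  map_poly h (twists U W k b) = twists (map_poly h U) (map_poly h W) k (map_poly h b).
Proof.
elim: k b => [|k IH] b //=; rewrite IH; congr twists.
by rewrite /twist rmorphD !rmorphM /= rmorphD rmorphMn /= !deriv_map.
Qed.

Section CharP.
Variables (R : comNzRingType) (p : nat).
Hypothesis pR : p \in [pchar R].
Implicit Types U W a b : {poly R}.

Let pcharX : p \in [pchar {poly R}].
Proof.
rewrite inE (pcharf_prime pR) /= -polyC_natr.
by rewrite (pcharf0 pR) polyC0.
Qed.

(** In characteristic p both C(p, j) for 0 < j < p and the p-th derivative
    vanish, so only the term j = 0 of Leibniz's rule survives: the p-th iterate is
    multiplication by a polynomial, W^p times the p-curvature. *)
Lemma twists_pchar U W b : twists U W p b = b * twists U W p 1.
Proof.
have p0 (x : {poly R}) : x *+ p = 0 by rewrite -mulr_natr (pcharf0 pcharX) mulr0.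
have pp := pcharf_prime pR; have p_gt0 := prime_gt0 pp.
rewrite -[in LHS](mulr1 b) twistsM big_ord_recl big1 => [|i _]; rewrite ?lift0.
  by rewrite addr0 bin0 subn0 expr0 mul1r mulr1n.
have := ltn_ord i; rewrite leq_eqVlt => /orP[/eqP ip|ip].
  rewrite ip nderivn_def.
  have /dvdnP[k ->] : (p %| p`!)%N by rewrite dvdn_fact // p_gt0 leqnn.
  by rewrite mulnC mulrnA p0 mul0rn mul0r mul0rn.
have /dvdnP[k ->] : (p %| 'C(p, i.+1))%N by apply: prime_dvd_bin.
by rewrite mulnC mulrnA p0 mul0rn.
Qed.

(** [twist U W j] depends only on j modulo p. *)
Lemma twists_pcharM U W k b :
  twists U W (k * p) b = b * twists U W p 1 ^+ k.
Proof.
have p0 (x : {poly R}) : x *+ p = 0 by rewrite -mulr_natr (pcharf0 pcharX) mulr0.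
have add_tw n c : twists U W (n * p + p) c = twists U W (n * p) (twists U W p c).
  suff aux i : twists U W (n * p + i) c = twists U W (n * p) (twists U W i c) by [].
  elim: i c => [|i IH] c; first by rewrite addn0.
  rewrite addnS /= IH; congr (twists _ _ _ (twists _ _ _ _)).
  by rewrite /twist mulrnDr mulnC mulrnA p0 mul0rn add0r.
elim: k b => [|k IH] b; first by rewrite expr0 mulr1.
by rewrite mulSnr add_tw IH twists_pchar exprS mulrA.
Qed.

End CharP.

(** * The functional sending X^n to f(n) *)
Definition umbra (f : nat -> int) (q : {poly int}) : int :=
  \sum_(i < size q) q`_i * f i.

Lemma umbra_widen f (q : {poly int}) n : (size q <= n)%N ->
  umbra f q = \sum_(i < n) q`_i * f i.
Proof.
move=> hn; rewrite /umbra (big_ord_widen _ (fun i => q`_i * f i) hn).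
rewrite big_mkcond; apply: eq_bigr => i _; case: ltnP => // hi.
by rewrite nth_default // mul0r.
Qed.

Lemma umbra_is_linear f : scalar (umbra f).
Proof.
move=> a q r; pose n := maxn (size (a *: q + r)) (maxn (size q) (size r)).
have [h1 h2 h3] : [/\ (size (a *: q + r)%R <= n)%N, (size q <= n)%N & (size r <= n)%N].
  by rewrite /n !leq_max !leqnn !orbT.
rewrite (umbra_widen f h1) (umbra_widen f h2) (umbra_widen f h3).
rewrite mulr_sumr -big_split /=; apply: eq_bigr => i _.
by rewrite coefD coefZ mulrDl -mulrA.
Qed.

HB.instance Definition _ f :=
  GRing.isLinear.Build int {poly int} int *%R (umbra f) (umbra_is_linear f).

Lemma umbraZ f a q : umbra f (a *: q) = a * umbra f q.
Proof. exact: linearZ. Qed.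

Lemma umbraCM f a q : umbra f (a%:P * q) = a * umbra f q.
Proof. by rewrite mul_polyC umbraZ. Qed.

Lemma umbraXn f n : umbra f 'X^n = f n.
Proof.
rewrite /umbra size_polyXn big_ord_recr /= coefXn eqxx mul1r big1 ?add0r // => i _.
by rewrite coefXn ltn_eqF // mul0r.
Qed.

Lemma umbraXnM f n (q : {poly int}) :
  umbra f ('X^n * q) = umbra (fun i => f (i + n)%N) q.
Proof.
rewrite -[q]coefK poly_def mulr_sumr !raddf_sum /=; apply: eq_bigr => i _.
by rewrite -scalerAr !linearZ /= -exprD !umbraXn addnC.
Qed.

Definition delta (f : nat -> int) n := f n.+1 - f n.

Lemma umbra_delta f q : umbra (delta f) q = umbra f (('X - 1) * q).
Proof.
rewrite mulrBl mul1r raddfB /= -['X]expr1 umbraXnM /umbra -sumrB.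
by apply: eq_bigr => i _; rewrite /delta addn1 mulrBr.
Qed.

Definition redp p (q : {poly int}) : {poly 'F_p} := map_poly intr q.

Lemma redp_eq0 p q : prime p -> redp p q = 0 -> exists r, q = p%:Z *: r.
Proof.
move=> pp q0; exists (map_poly (fun c => (c %/ p)%Z) q).
apply/polyP => i; rewrite coefZ coef_map_id0 ?div0z // mulrC divzK //.
have /eqP : (redp p q)`_i = 0 by rewrite q0 coef0.
by rewrite coef_map /= -(dvdz_pcharf (pchar_Fp pp)).
Qed.

Lemma umbra_redp_eq0 p f q : prime p -> redp p q = 0 -> (p %| umbra f q)%Z.
Proof.
by move=> pp /(redp_eq0 pp)[r ->]; rewrite linearZ /= dvdz_mulr.
Qed.

Lemma umbra_period p f q : prime p ->
  (forall n, (f (n + p)%N = f n %[mod p])%Z) -> (p %| umbra f (('X - 1) ^+ p * q))%Z.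
Proof.
move=> pp per.
have -> : umbra f (('X - 1) ^+ p * q) =
    umbra f ((('X - 1) ^+ p - ('X^p - 1)) * q) + umbra f (('X^p - 1) * q).
  by rewrite -raddfD /= -mulrDl subrK.
apply: rpredD.
  apply: umbra_redp_eq0 => //; rewrite /redp rmorphM /= rmorphB rmorphXn /= rmorphB /=.
  rewrite map_polyX rmorph1 rmorphB /= map_polyXn rmorph1.
  have ch : p \in [pchar {poly 'F_p}].
    by rewrite inE pp /= -polyC_natr (pcharf0 (pchar_Fp pp)) polyC0.
  rewrite -!(pFrobenius_autE ch) pFrobenius_autB_comm; last exact: mulrC.
  by rewrite !pFrobenius_autE expr1n subrr mul0r.
rewrite mulrBl mul1r raddfB /= umbraXnM /umbra -sumrB.
apply: rpred_sum => i _; rewrite -mulrBr dvdz_mull //.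
by rewrite -eqz_mod_dvd; apply/eqP.
Qed.

Lemma polyXsub1_div (y : {poly int}) : exists r, y = y.[1]%:P + ('X - 1) * r.
Proof.
have /factor_theorem[r Hr] : root (y - y.[1]%:P) 1.
  by rewrite rootE hornerD hornerN hornerC subrr.
by exists r; rewrite mulrC -[1 in X in _ * X]polyC1 -Hr addrC subrK.
Qed.

(** Expand [y] in powers of t. *)
Lemma umbra_tail (p : int) f d :
  (forall m, (d <= m)%N -> (p %| umbra f (('X - 1) ^+ m))%Z) ->
  forall y, (p %| umbra f (('X - 1) ^+ d * y))%Z.
Proof.
move=> H y; have [n] := ubnP (size y); elim: n d y H => // n IH d y H hn.
have [->|y0] := eqVneq y 0; first by rewrite mulr0 raddf0 dvdz0.
have [r Hr] := polyXsub1_div y.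
rewrite Hr mulrDr raddfD /= rpredD //.
  by rewrite mulrC mul_polyC linearZ /= dvdz_mull // H.
rewrite mulrA -exprSr; apply: IH => [m hm|]; first by apply: H; apply: ltnW.
have [->|r0] := eqVneq r 0.
  by rewrite size_poly0; move: hn; rewrite ltnS; apply: leq_trans; rewrite size_poly_gt0.
have : (size (('X - 1) * r)%R <= size y)%N.
  have -> : ('X - 1) * r = y - y.[1]%:P by rewrite {1}Hr [_ + _ * r]addrC addrK.
  apply: leq_trans (size_polyD _ _) _; rewrite size_polyN geq_max leqnn /=.
  by apply: leq_trans (size_polyC_leq1 _) _; rewrite size_poly_gt0.
rewrite -polyC1 mulrC size_Mmonic ?monicXsubC // size_XsubC addn2 /= => h.
by move: hn; rewrite ltnS; apply: leq_trans.
Qed.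

Lemma umbra_head (p : int) f d y :
  (forall m, (d < m)%N -> (p %| umbra f (('X - 1) ^+ m))%Z) ->
  (p %| umbra f (('X - 1) ^+ d * y) - y.[1] * umbra f (('X - 1) ^+ d))%Z.
Proof.
move=> H; have [r Hr] := polyXsub1_div y.
rewrite {1}Hr mulrDr raddfD /= [_ * y.[1]%:P]mulrC mul_polyC linearZ /= addrAC subrr add0r.
by rewrite mulrA -exprSr; apply: umbra_tail.
Qed.

(** Past [p] the differences are divisible by [p], so it is enough to descend one
    step at a time. *)
Lemma umbra_descent p f e : prime p ->
  (forall n, (f (n + p)%N = f n %[mod p])%Z) ->
  (forall d, (e <= d)%N ->
     (forall m, (d < m)%N -> (p %| umbra f (('X - 1) ^+ m))%Z) ->
     (p %| umbra f (('X - 1) ^+ d))%Z) ->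
  forall m, (e <= m)%N -> (p %| umbra f (('X - 1) ^+ m))%Z.
Proof.
move=> pp per step m em.
suff H i : forall m, (e <= m)%N -> (p - i <= m)%N -> (p %| umbra f (('X - 1) ^+ m))%Z.
  by apply: (H p) => //; rewrite subnn.
elim: i => [|i IH] {em}m em hm.
  by rewrite -(subnKC hm) subn0 exprD; apply: umbra_period.
have [h|h] := leqP (p - i) m; first exact: IH.
apply: step => // k mk; apply: IH; first by apply: leq_trans (ltnW mk).
by move: hm mk h; lia.
Qed.

(** * Consequences of a first order relation *)

(** In terms of the generating function, the sum of f(n) / X^(n+1): it satisfies
    an inhomogeneous linear differential equation of order one. *)
Definition annihilates f (U W : {poly int}) :=
  forall q, umbra f (U * q + W * q^`()) = 0.

(** Integration by parts: the adjoint of the k-fold iterate is W^k times the k-th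
    derivative. *)
Lemma umbra_twists f U W k b q : annihilates f U W ->
  umbra f (twists U W k b * q) = (-1) ^+ k * umbra f (W ^+ k * b * q^`(k)).
Proof.
move=> rel; elim: k b q => [|k IH] b q; first by rewrite !expr0 !mul1r.
rewrite /= IH; have := twist_mulW U W k 0 b; rewrite addn0 => ->.
have -> : twist U W 0 (W ^+ k * b) * q^`(k) =
    (U * (W ^+ k * b * q^`(k)) + W * (W ^+ k * b * q^`(k))^`())
    - W ^+ k.+1 * b * q^`(k.+1).
  by rewrite /twist mulr0n addr0 [(_ * _ * _)^`()]derivM derivnS exprS; ring.
by rewrite raddfB /= rel sub0r [(-1) ^+ k.+1]exprS mulrN mulN1r mulNr.
Qed.

(** A k-th derivative of an integer polynomial is divisible by k!. *)
Lemma umbra_twists_dvd f U W k b q : annihilates f U W ->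
  (k`!%:Z %| umbra f (twists U W k b * q))%Z.
Proof.
move=> /umbra_twists ->; apply: dvdz_mull.
rewrite nderivn_def -mulr_natr mulrA mulrC -polyC_natr mul_polyC linearZ /=.
by rewrite natz dvdz_mulr.
Qed.

Lemma expn_dvd_fact p k : (0 < p)%N -> (p ^ k %| (k * p)`!)%N.
Proof.
move=> p0; elim: k => // k IH.
have h : (k * p <= k.+1 * p)%N by rewrite leq_mul2r leqnSn orbT.
rewrite -(bin_fact h) dvdn_mull // expnSr dvdn_mul //.
by rewrite mulSn addnK dvdn_fact // p0 leqnn.
Qed.

Lemma redp_lift p (q : {poly 'F_p}) :
  redp p (map_poly (fun x : 'F_p => (x : nat)%:Z) q) = q.
Proof.
by apply/polyP => i; rewrite /redp coef_map /= coef_map_id0 //= -pmulrn natr_Zp.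
Qed.

(** Division by [u] modulo p^k although the leading coefficient of [u] need not be
    a unit: by successive approximation, only the degree of [u] modulo p counts. *)
Lemma euclid_padic p u k q : prime p -> redp p u != 0 ->
  exists r a b, q = r + u * a + (p ^ k)%:Z *: b /\ (size r < size (redp p u))%N.
Proof.
move=> pp u0; pose lift (s : {poly 'F_p}) := map_poly (fun x : 'F_p => (x : nat)%:Z) s.
elim: k => [|k [r [a [b [-> hr]]]]].
  exists 0, 0, q; rewrite mulr0 !add0r expn0 scale1r; split => //.
  by rewrite size_poly0 size_poly_gt0.
have : redp p (b - (lift (redp p b %/ redp p u) * u + lift (redp p b %% redp p u))) = 0.
  rewrite {1}/redp rmorphB rmorphD rmorphM /=.
  by rewrite -/(redp p _) -/(redp p _) -/(redp p _) -/(redp p _) !redp_lift -divp_eq subrr.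
case/redp_eq0 => // c /eqP; rewrite subr_eq => /eqP ->.
exists (r + (p ^ k)%:Z *: lift (redp p b %% redp p u)),
  (a + (p ^ k)%:Z *: lift (redp p b %/ redp p u)), c; split.
  by rewrite expnSr PoszM -!mul_polyC rmorphM /=; ring.
rewrite (leq_ltn_trans (size_polyD _ _)) // gtn_max hr /=.
apply: leq_ltn_trans (size_scale_leq _ _) _.
apply: leq_ltn_trans (size_poly _ _) _; exact: ltn_modpN0.
Qed.

Lemma umbra_lowdeg f (chi r : {poly int}) m : (size r <= m)%N ->
  (forall i, (i < m)%N -> umbra f (chi * 'X^i) = 0) -> umbra f (chi * r) = 0.
Proof.
move=> hr H; rewrite -[r]coefK poly_def mulr_sumr raddf_sum /= big1 // => i _.
by rewrite -scalerAr linearZ /= H ?mulr0 // (leq_trans _ hr).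
Qed.

(** Reduce X^m modulo p^k by the (kp)-fold iterate, k = m / (pe).  That iterate is
    nonzero modulo p, of degree at most m, so the remainder has degree below m and
    does not contribute; the iterate itself contributes a multiple of (kp)!. *)
Lemma annihilator_dvd p f U W e chi m : prime p -> annihilates f U W ->
  (size U <= e.+1)%N -> (size W <= e.+1)%N ->
  redp p (twists U W p 1) != 0 ->
  (forall i, (i < m)%N -> umbra f (chi * 'X^i) = 0) ->
  ((p ^ (m %/ (p * e)))%:Z %| umbra f (chi * 'X^m))%Z.
Proof.
move=> pp rel hU hW psi0 H; set k := (_ %/ _)%N.
pose u := twists U W (k * p) 1.
have redu : redp p u = redp p (twists U W p 1) ^+ k.
  by rewrite /redp !map_twists /= twists_pcharM ?pchar_Fp // rmorph1 mul1r.
have u0 : redp p u != 0 by rewrite redu expf_neq0.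
have [r [a [b [Xm hr]]]] := euclid_padic k 'X^m pp u0.
rewrite Xm !mulrDr !raddfD /= (umbra_lowdeg _ H) ?add0r; last first.
  rewrite -ltnS; apply: leq_trans hr _.
  apply: leq_trans (size_poly _ _) _.
  apply: leq_trans (size_twists _ _ hU hW) _.
  by rewrite size_poly1 add1n ltnS -mulnA leq_trunc_div.
rewrite rpredD //; last by rewrite -scalerAr linearZ /= dvdz_mulr.
rewrite mulrCA; apply: dvdz_trans (umbra_twists_dvd _ _ _ rel).
exact: expn_dvd_fact (prime_gt0 pp).
Qed.

(** When W vanishes at 1, the operators preserve the order at t = 0 and act on the
    leading term through the indicial polynomial. *)
Lemma twists_order U W1 k d y : exists S,
  twists U (('X - 1) * W1) k (('X - 1) ^+ d * y) = ('X - 1) ^+ d * S /\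
  S.[1] = (\prod_(j < k) (U.[1] + W1.[1] *+ (d + j))) * y.[1] :> int.
Proof.
elim: k y => [|k IH] y; first by exists y; rewrite big_ord0 mul1r.
have der : (('X - 1) ^+ d : {poly int})^`() * ('X - 1) = ('X - 1) ^+ d *+ d.
  case: (d) => [|n]; first by rewrite expr0 derivC mul0r.
  by rewrite deriv_exp derivB derivX derivC subr0 mul1r mulrnAl -exprSr.
pose z := (U + (W1 + ('X - 1) * W1^`()) *+ k + W1 *+ d) * y + ('X - 1) * W1 * y^`().
have tz : twist U (('X - 1) * W1) k (('X - 1) ^+ d * y) = ('X - 1) ^+ d * z.
  rewrite /twist /z [(('X - 1) * W1)^`()]derivM [(_ ^+ d * y)^`()]derivM.
  rewrite derivB derivX derivC subr0.
  rewrite mul1r; apply/eqP; rewrite -subr_eq0; apply/eqP.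
  transitivity (W1 * y * ((('X - 1) ^+ d)^`() * ('X - 1) - ('X - 1) ^+ d *+ d)).
    by ring.
  by rewrite der subrr mulr0.
have [S [HS HS1]] := IH z; exists S; rewrite /= tz HS; split => //.
rewrite HS1 big_ord_recr /= -mulrA; congr (_ * _).
rewrite /z !hornerE /= hornerMn !hornerE /= hornerMn.
by rewrite mulrnDr -addrA [W1.[1] *+ k + _]addrC.
Qed.

Lemma prime_dvdzM (p : nat) (x y : int) : prime p -> ~~ (p %| y)%Z ->
  (p %| x * y)%Z -> (p %| x)%Z.
Proof.
by move=> pp; rewrite !dvdzE abszM Euclid_dvdM //= => /negPf ->; rewrite orbF.
Qed.

Lemma dvdz_small (n : nat) (x : int) : (n %| x)%Z -> (`|x| < n)%N -> x = 0.
Proof.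
move=> + h; rewrite dvdzE /= => d; apply/eqP; rewrite -absz_eq0.
by apply: contraLR h; rewrite -leqNgt -lt0n => h; apply: dvdn_leq.
Qed.

Lemma absz_lt_square (p d : nat) (u w : int) :
  (`|u| + `|w| < p)%N -> (d < p)%N -> (`|(u + w * d)%R| < p * p)%N.
Proof.
move=> small dp; have tri (a b : int) : (`|(a + b)%R| <= `|a| + `|b|)%N by lia.
apply: leq_ltn_trans (tri _ _) _; rewrite abszM /=.
apply: (@leq_trans (`|w|.+1 * p)); last by rewrite leq_mul2r; apply/orP; right; lia.
rewrite mulSn -addSn leq_add ?leq_mul2l ?(ltnW dp) ?orbT //.
by apply: leq_ltn_trans small; apply: leq_addr.
Qed.

(** The exponent d of the last difference prime to [p] is a root modulo p^2 of the
    indicial polynomial x |-> U(1) + x W'(1), hence an exact root, so that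
    d <= |U(1)|. *)
Lemma zero_curvature p f U W1 : prime p ->
  (forall n, (f (n + p)%N = f n %[mod p])%Z) ->
  annihilates f U (('X - 1) * W1) ->
  (U.[1] != 0) || (W1.[1] != 0) ->
  (`|U.[1]| + `|W1.[1]| < p)%N ->
  redp p (twists U (('X - 1) * W1) p 1) = 0 ->
  forall m, (`|U.[1]| < m)%N -> (p %| umbra f (('X - 1) ^+ m))%Z.
Proof.
move=> pp per rel nz small psi0; apply: umbra_descent => // d Ud tail.
apply/negPn/negP => ad.
have dp : (d < p)%N.
  rewrite ltnNge; apply: contra ad => pd; rewrite -(subnKC pd) exprD.
  exact: umbra_period.
(* Beyond [d] all differences are divisible by [p], so on t^d y
   the functional sees only y(1). *)
have head y : umbra f (('X - 1) ^+ d * y) = 0 -> (p %| y.[1])%Z.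
  move=> y0; apply: (prime_dvdzM pp ad).
  by have := umbra_head y tail; rewrite y0 sub0r rpredN.
set u := U.[1] in nz small Ud *; set w := W1.[1] in nz small *.
have d1 n : (0 < n)%N -> (1 : {poly int})^`(n) = 0.
  by case: n => // n _; rewrite -polyC1 derivnC.
have [S [HS HS1]] := twists_order U W1 p d 1.
(* t^d S is the p-fold iterate of t^d, which is 0 modulo p as the curvature is. *)
have [S' HS'] : exists r, S = p%:Z *: r.
  apply: redp_eq0 => //; apply/eqP; move: (congr1 (redp p) HS).
  rewrite /redp map_twists /= mulr1 twists_pchar ?pchar_Fp //.
  move: psi0; rewrite /redp map_twists /= rmorph1 => ->.
  rewrite mulr0 rmorphM /= => /esym/eqP; rewrite mulf_eq0 => /orP[|//].
  rewrite rmorphXn /= rmorphB /= map_polyX rmorph1 expf_eq0 => /andP[_].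
  by rewrite -polyC1 polyXsubC_eq0.
have pS' : (p %| S'.[1])%Z.
  apply: head; apply: (@mulfI _ p%:Z); first by have := prime_gt0 pp; lia.
  rewrite mulr0 -linearZ /= scalerAr -HS' -HS -[twists _ _ _ _]mulr1.
  by rewrite umbra_twists // d1 ?prime_gt0 // mulr0 raddf0 mulr0.
have px : (p %| u + w *+ d)%Z.
  have [T [HT HT1]] := twists_order U W1 1 d 1.
  have -> : u + w *+ d = T.[1] by rewrite HT1 big_ord1 addn0 hornerC mulr1.
  apply: head; rewrite -HT -[twists _ _ _ _]mulr1 umbra_twists //.
  by rewrite d1 // mulr0 raddf0 mulr0.
have pw : ~~ (p %| w)%Z.
  apply/negP => pw.
  have w0 : w = 0 by apply: dvdz_small pw _; lia.
  have u0 : u = 0.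
    by apply: (@dvdz_small p); [move: px; rewrite w0 mul0rn addr0|lia].
  by move: nz; rewrite u0 w0 eqxx.
have pprod : ~~ (p %| \prod_(j < p.-1) (u + w *+ (d + j.+1)))%Z.
  elim/big_ind: _ => [|a b ha hb|j _].
  - by rewrite dvdzE /= dvdn1; have := prime_gt1 pp; lia.
  - by rewrite dvdzE abszM Euclid_dvdM // negb_or; rewrite !dvdzE in ha hb; apply/andP.
  rewrite mulrnDr addrA rpredDl // -mulr_natr natz.
  apply: contra pw => /(prime_dvdzM pp); apply.
  rewrite dvdzE /= gtnNdvd //; have := ltn_ord j; have := prime_gt1 pp; lia.
(* S(1) is the product of the U(1) + (d + j) W'(1) over j < p, it is divisible by
   p^2, and [p] divides only the factor j = 0. *)
have ppx : ((p * p)%N %| u + w *+ d)%Z.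
  have /dvdzP[c Hc] := px; have /dvdzP[s Hs] := pS'.
  have prod_recl (F : nat -> int) :
      \prod_(j < p) F j = F 0%N * \prod_(j < p.-1) F j.+1.
    by case: (p) (prime_gt0 pp) => // n _; rewrite big_ord_recl.
  move: HS1; rewrite HS' hornerZ hornerC mulr1 (prod_recl (fun j => _ + _ *+ (d + j))).
  rewrite addn0 -/u -/w Hs Hc PoszM => Hcs.
  rewrite dvdz_mul //; apply: (prime_dvdzM pp pprod).
  apply/dvdzP; exists s; apply: (@mulfI _ p%:Z).
    by have := prime_gt0 pp; lia.
  by rewrite Hcs; ring.
have xbound : (`|(u + w *+ d)%R| < p * p)%N.
  by rewrite -mulr_natr natz; apply: absz_lt_square.
have /eqP := dvdz_small ppx xbound; rewrite addr_eq0 => /eqP uw.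
have w0 : (0 < `|w|)%N by rewrite lt0n absz_eq0; apply: contraNneq pw => ->.
by move: Ud; rewrite uw abszN -mulr_natr natz abszM /= ltnNge leq_pmull.
Qed.

(** * Integer relations by counting *)
Lemma pigeonhole_fiber (T : finType) (N : nat) (S : {set T}) (key : T -> 'I_N.+1) :
  exists k, (#|S| <= #|[set v in S | key v == k]| * N.+1)%N.
Proof.
pose F k := #|[set v in S | key v == k]|.
exists [arg max_(k > ord0) F k]; case: arg_maxnP => // k _ kmax.
have -> : #|S| = (\sum_k F k)%N.
  rewrite -sum1_card (partition_big key xpredT) //=; apply: eq_bigr => j _.
  by rewrite /F -sum1_card; apply: eq_bigl => v; rewrite inE.
have le : (\sum_(j < N.+1) F j <= \sum_(j < N.+1) F k)%N.
  by apply: leq_sum => j _; apply: kmax.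
by apply: leq_trans le _; rewrite sum_nat_const card_ord mulnC.
Qed.

(** Siegel's lemma for sequences [h i] whose combinations have hidden divisibility:
    a combination vanishing below [m] is divisible by [D m] at [m].  Coefficients are
    taken in the box of sides [X i]. *)
Section IntegerRelation.
Variables (I : finType) (h : I -> nat -> int) (X : I -> nat) (D : nat -> nat) (M : nat).

Definition combination (A : I -> int) n := \sum_i A i * h i n.
Definition combination_bound n := (\sum_i X i * `|h i n|)%N.

Hypothesis D_gt0 : forall n, (0 < D n)%N.
Hypothesis combination_dvd : forall A m,
  (forall i, (i < m)%N -> combination A i = 0) -> ((D m)%:Z %| combination A m)%Z.
Hypothesis box_large :
  (\prod_(n < M) (2 * (combination_bound n %/ D n)).+1 < \prod_i (X i).+1)%N.
Hypothesis combination_small : forall n, (M <= n)%N -> (combination_bound n < D n)%N.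

Let box := {dffun forall i : I, 'I_(X i).+1}.
Let diff (v w : box) i : int := (v i)%:Z - (w i)%:Z.

Let combination_diff v w n : combination (diff v w) n =
  combination (fun i => (v i)%:Z) n - combination (fun i => (w i)%:Z) n.
Proof. by rewrite /combination -sumrB; apply: eq_bigr => i _; rewrite -mulrBl. Qed.

Let combination_le v w n : (`|combination (diff v w) n| <= combination_bound n)%N.
Proof.
rewrite /combination /combination_bound; elim/big_rec2: _ => [|i y x _ IH].
  by rewrite absz0.
have : (`|diff v w i| <= X i)%N.
  by rewrite /diff; have := ltn_ord (v i); have := ltn_ord (w i); lia.
move=> hd; have : (`|(diff v w i * h i n)%R| <= X i * `|h i n|)%N.
  by rewrite abszM leq_mul2r hd orbT.
by lia.
Qed.

(** Among combinations that agree below [m], the values at [m] lie in a single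
    class modulo [D m] and differ by at most the bound, which leaves
    2 (bound / D m) + 1 possibilities. *)
Let agreeing m : exists S : {set box},
  (forall v w, v \in S -> w \in S -> forall i, (i < m)%N -> combination (diff v w) i = 0) /\
  (\prod_i (X i).+1 <= #|S| * \prod_(n < m) (2 * (combination_bound n %/ D n)).+1)%N.
Proof.
elim: m => [|m [S [HS HSc]]].
  exists finset.setT; split => //; rewrite big_ord0 muln1 cardsT card_dep_ffun.
  by rewrite foldrE big_map big_enum /=; under [X in (_ <= X)%N]eq_bigr do rewrite card_ord.
have [S0|[v0 v0S]] := set_0Vmem S.
  have : (0 < \prod_i (X i).+1)%N by apply: prodn_gt0.
  by move: HSc; rewrite S0 cards0 mul0n leqNgt => /negPf ->.
pose quo v := (combination (diff v v0) m %/ D m)%Z.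
pose c := (combination_bound m %/ D m)%N.
have quoE v : v \in S -> combination (diff v v0) m = quo v * D m.
  by move=> vS; rewrite divzK //; apply: combination_dvd => i; apply: HS.
have quo_le v : v \in S -> (`|quo v| <= c)%N.
  by move=> vS; rewrite leq_divRL // -[D m]/(`|D m|%N) -abszM -quoE.
pose key v : 'I_(2 * c).+1 := inord `|(quo v + c)%R|%N.
have [k Hk] := pigeonhole_fiber S key.
exists [set v in S | key v == k]; split; last first.
  rewrite big_ord_recr /=; apply: leq_trans HSc _.
  by rewrite [X in (_ <= _ * X)%N]mulnC mulnA leq_mul2r Hk orbT.
move=> v w; rewrite !inE => /andP[vS /eqP kv] /andP[wS /eqP kw] i.
rewrite ltnS leq_eqVlt => /predU1P[->|]; last exact: HS.
have : quo v = quo w.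
  have := quo_le _ vS; have := quo_le _ wS => qw qv.
  move: (congr1 (@nat_of_ord _) kv) (congr1 (@nat_of_ord _) kw).
  by rewrite /key !inordK; lia.
have := quoE _ vS; have := quoE _ wS; rewrite !combination_diff => Hw Hv Hq.
by rewrite -(subrK (combination (fun i => v0 i) m) (combination _ m)) Hv Hq -Hw; ring.
Qed.

(** Two coefficient vectors agree below [M].  Their difference vanishes there, hence
    everywhere: at each later place its value is a multiple of [D n] smaller than
    [D n]. *)
Lemma integer_relation : exists A : I -> int,
  (exists i, A i != 0) /\ forall n, combination A n = 0.
Proof.
have [S [HS HSc]] := agreeing M.
have : (1 < #|S|)%N.
  rewrite ltnNge; apply/negP => S1; move: box_large; rewrite ltnNge => /negP; apply.
  by apply: leq_trans HSc _; rewrite -[X in (_ <= X)%N]mul1n leq_mul2r S1 orbT.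
case/card_gt1P => v [w [vS wS vw]]; exists (diff v w); split.
  apply/existsP; rewrite -negb_forall; apply: contra vw => /forallP H.
  by apply/eqP/ffunP => i; apply: val_inj; apply/eqP; have := H i; rewrite subr_eq0.
move=> n; have [m] := ubnP n; elim: m n => // m IH n nm.
have [nM|Mn] := ltnP n M; first exact: HS.
have := combination_small Mn; rewrite ltnNge => /negP small.
apply/eqP/negPn/negP => cn; apply: small; apply: leq_trans (combination_le v w n).
have : ((D n)%:Z %| combination (diff v w) n)%Z.
  by apply: combination_dvd => i ni; apply: IH; apply: leq_trans ni _.
by rewrite dvdzE /=; apply: dvdn_leq; rewrite absz_gt0.
Qed.

End IntegerRelation.

(** * Relations between shifts of a sequence of exponential growth *)
Lemma exists_nat_ge (R : realType) (x : R) : exists n : nat, x <= n%:R.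
Proof.
have [h|h] := leP 0 x; last by exists 0%N; apply: ltW.
by exists (Num.truncn x).+1; case/andP: (truncn_itv h) => _ /ltW.
Qed.

Lemma poly_le_expR (R : realType) (m : nat) (d : R) : 0 < d ->
  exists2 Q : R, 0 < Q & forall n : nat, n.+1%:R ^+ m <= Q * expR (d * n%:R).
Proof.
move=> d0; have [x x0 dE] : exists2 x, 0 < x & d = m.+1%:R * x.
  by exists (d / m.+1%:R); [rewrite divr_gt0 | rewrite mulrC divfK ?pnatr_eq0].
exists (x ^- m.+1 * expR d) => [|n]; first by rewrite mulr_gt0 ?expR_gt0 ?invr_gt0 ?exprn_gt0.
rewrite -mulrA -expRD -[d in d + _]mulr1 -mulrDr nat1r.
have -> : expR (d * n.+1%:R) = expR (x * n.+1%:R) ^+ m.+1.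
  by rewrite -expRM_natl dE mulrA.
rewrite mulrC ler_pdivlMr ?exprn_gt0 //.
apply: (@le_trans _ _ ((x * n.+1%:R) ^+ m.+1)).
  rewrite exprMn mulrC; apply: ler_wpM2l; first by rewrite exprn_ge0 ?(ltW x0).
  by rewrite exprS ler_peMl ?exprn_ge0 // ler1n.
rewrite lerXn2r ?nnegrE ?expR_ge0 ?mulr_ge0 ?(ltW x0) //.
by apply: le_trans (expR_ge1Dx _); rewrite lerDr.
Qed.

Lemma sum_natr (R : realType) n : \sum_(i < n) (i%:R : R) = n%:R * (n%:R - 1) / 2.
Proof.
elim: n => [|n IH]; first by rewrite big_ord0 !mul0r.
by rewrite big_ord_recr /= IH -natr1; field.
Qed.

Definition column (f : nat -> int) (L K : nat) (i : 'I_L * 'I_K) (n : nat) : int :=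
  n%:Z ^+ i.1 * f (n + i.2)%N.

Lemma box_degree_arith (F : realFieldType) (G Q K : F) :
  0 < G -> 0 < Q -> 0 <= K -> (G + 1) * Q <= K -> Q * (G * K + 1) <= (K + 1) ^+ 2.
Proof. by move=> *; nra. Qed.

(** Twice the difference of the two sides is at least g L K^2 / 2 - g K; the gain
    comes from the factor e^(gK) by which the box of coefficients is enlarged. *)
Lemma box_exponent_arith (F : realFieldType) (c g L K : F) :
  0 < c -> 0 < g -> 1 <= L -> 3 <= K ->
  L * K * (g / 4 * K) + (c + g) * (K * (L * K + 1) / 2) <
  L * (c * (K * (K + 1) / 2) + g * K ^+ 2).
Proof.
move=> c0 g0 L1 K3; have K0 : 0 < K by lra.
have h1 : K * c * 1 <= K * c * L by rewrite ler_pM2l // mulr_gt0.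
have h2 : g * K * 3 <= g * K * (L * K).
  by rewrite ler_pM2l ?mulr_gt0 // -[3]mul1r ler_pM.
have h3 : 0 < g * K by rewrite mulr_gt0.
by clear -h1 h2 h3; lra.
Qed.

(** The slack [s] in c (L + 1) < b L is shared between [gam], which enlarges the box
    of coefficients, and [del], which absorbs the powers of n. *)
Section Relation.
Variables (R : realType) (c b C B : R) (L : nat) (f : nat -> int) (D : nat -> nat).
Hypotheses (c0 : 0 < c) (C0 : 0 < C) (B0 : 0 < B) (L0 : (0 < L)%N).
Hypothesis cb : c * L.+1%:R < b * L%:R.
Hypothesis f_le : forall n, (`|f n|%N)%:R <= C * expR (c * n%:R).
Hypothesis D_ge : forall n, B * expR (b * n%:R) <= (D n)%:R.
Hypothesis D_dvd : forall K (A : 'I_L * 'I_K -> int) m,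
  (forall i, (i < m)%N -> combination (@column f L K) A i = 0) ->
  ((D m)%:Z %| combination (@column f L K) A m)%Z.

Let s := b * L%:R - c * L.+1%:R.
Let gam := s / 2.
Let del := s / (2 * L%:R).

Let LR0 : 0 < L%:R :> R. Proof. by rewrite ltr0n. Qed.
Let s0 : 0 < s. Proof. by rewrite /s subr_gt0. Qed.
Let gam0 : 0 < gam. Proof. by rewrite /gam divr_gt0. Qed.
Let del0 : 0 < del. Proof. by rewrite /del divr_gt0 ?mulr_gt0. Qed.
Let b_split : b = c + (c + gam) / L%:R + del.
Proof. by rewrite /gam /del /s -natr1; field; rewrite lt0r_neq0. Qed.

(** The sides decrease with the shift so that, up to powers of n, every term of the
    combination has the same size e^((c + gam) K + c n). *)
Let X K (i : 'I_L * 'I_K) : nat :=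
  Num.truncn (expR (c * (K%:R - i.2%:R) + gam * K%:R)).

Let X_le K (i : 'I_L * 'I_K) : (X i)%:R <= expR (c * (K%:R - i.2%:R) + gam * K%:R).
Proof. by case/andP: (truncn_itv (expR_ge0 (c * (K%:R - i.2%:R) + gam * K%:R))). Qed.

Let X_gt K (i : 'I_L * 'I_K) : expR (c * (K%:R - i.2%:R) + gam * K%:R) <= (X i).+1%:R.
Proof. by case/andP: (truncn_itv (expR_ge0 (c * (K%:R - i.2%:R) + gam * K%:R))) => _ /ltW. Qed.

Let bound_le K n : (combination_bound (@column f L K) (@X K) n)%:R <=
  (L%:R * C) * (K%:R * n.+1%:R ^+ L) * expR ((c + gam) * K%:R + c * n%:R).
Proof.
rewrite /combination_bound natr_sum.
have term (i : 'I_L * 'I_K) : (X i * `|column f i n|)%N%:R <=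
    C * (n.+1%:R ^+ L * expR ((c + gam) * K%:R + c * n%:R)).
  have -> : (c + gam) * K%:R + c * n%:R =
      (c * (K%:R - i.2%:R) + gam * K%:R) + c * (n + i.2)%:R by rewrite natrD; ring.
  have colE : (`|column f i n|%N)%:R <= n.+1%:R ^+ L * (C * expR (c * (n + i.2)%:R)).
    rewrite /column abszM abszX natrM natrX.
    apply: ler_pM; rewrite ?exprn_ge0 //.
    apply: (@le_trans _ _ (n.+1%:R ^+ i.1)); last by rewrite ler_weXn2l ?ler1n // ltnW.
    by rewrite lerXn2r ?nnegrE // ler_nat.
  rewrite natrM expRD.
  apply: le_trans (ler_pM _ _ (X_le i) colE) _ => //.
  by rewrite le_eqVlt; apply/orP; left; apply/eqP; ring.
apply: le_trans (ler_sum _ (fun i _ => term i)) _.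
rewrite sumr_const card_prod !card_ord.
by rewrite -[X in X <= _]mulr_natl natrM le_eqVlt; apply/orP; left; apply/eqP; ring.
Qed.

Let c_gam_gt0 : 0 < c + gam. Proof. exact: addr_gt0. Qed.

(** Compared with D_n >= B e^(bn), what remains is e^((c + gam) (K - n / L)), which is
    large only for n < L K, the number of columns. *)
Let bound_le_shape K n : (combination_bound (@column f L K) (@X K) n)%:R <=
  (L%:R * C) * K%:R * (n.+1%:R ^+ L * expR (- (del * n%:R))) *
  (expR (b * n%:R) * expR ((c + gam) * (K%:R - n%:R / L%:R))).
Proof.
apply: le_trans (bound_le K n) _.
have -> : (c + gam) * K%:R + c * n%:R =
    - (del * n%:R) + (b * n%:R + (c + gam) * (K%:R - n%:R / L%:R)).
  by rewrite b_split; field; rewrite lt0r_neq0.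
by rewrite !expRD le_eqVlt; apply/orP; left; apply/eqP; ring.
Qed.

Let row_count_le K Q n : 0 < Q -> n.+1%:R ^+ L <= Q * expR (del * n%:R) -> (n < L * K)%N ->
  (2 * (combination_bound (@column f L K) (@X K) n %/ D n)).+1%:R <=
  (2 * (L%:R * C) / B * Q * K%:R + 1) * expR ((c + gam) * (K%:R - n%:R / L%:R)).
Proof.
move=> Q0 HQ nLK; set e := expR ((c + gam) * _).
set Y := combination_bound _ _ _; set q := (Y %/ D n)%N.
have e1 : 1 <= e.
  apply: le_trans (expR_ge1Dx _); rewrite lerDl mulr_ge0 ?(ltW c_gam_gt0) // subr_ge0.
  by rewrite ler_pdivrMr // -natrM ler_nat mulnC ltnW.
have qD : q%:R * (B * expR (b * n%:R)) <= Y%:R.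
  apply: le_trans (ler_wpM2l _ (D_ge n)) _ => //.
  by rewrite -natrM ler_nat leq_trunc_div.
have Yle : Y%:R <= (L%:R * C) * K%:R * Q * (expR (b * n%:R) * e).
  apply: le_trans (bound_le_shape K n) _; rewrite ler_wpM2r ?mulr_ge0 ?expR_ge0 //.
  rewrite ler_wpM2l ?mulr_ge0 ?(ltW C0) //.
  by rewrite expRN ler_pdivrMr ?expR_gt0.
have {}qD := le_trans qD Yle.
have qle : q%:R <= (L%:R * C) / B * Q * K%:R * e.
  have := expR_gt0 (b * n%:R); move: qD; set eb := expR _ => qD eb0.
  have BeB : 0 < B * eb by apply: mulr_gt0.
  rewrite -(ler_pM2r BeB); apply: le_trans qD _.
  by rewrite le_eqVlt; apply/orP; left; apply/eqP; field; rewrite lt0r_neq0.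
rewrite -addn1 natrD natrM [leRHS]mulrDl mul1r; apply: lerD => //.
move: qle; set x := _ * e => qle; apply: le_trans (ler_wpM2l _ qle) _ => //.
by rewrite /x le_eqVlt; apply/orP; left; apply/eqP; ring.
Qed.

(** One more factor n + 1 absorbs K, another one makes the inequality strict. *)
Let row_small K Q n : (forall m : nat, m.+1%:R ^+ L.+2 <= Q * expR (del * m%:R)) ->
  2 * (L%:R * C) / B * Q <= K%:R -> (L * K <= n)%N ->
  (combination_bound (@column f L K) (@X K) n < D n)%N.
Proof.
move=> HQ KQ LKn; rewrite -(ltr_nat R); apply: lt_le_trans (D_ge n).
have Kn : (K <= n)%N by apply: leq_trans LKn; apply: leq_pmull.
set eb := expR (b * n%:R); have eb0 : 0 < eb by apply: expR_gt0.
have e1 : expR ((c + gam) * (K%:R - n%:R / L%:R)) <= 1.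
  rewrite -[leRHS]expR0 ler_expR; apply: mulr_ge0_le0; first exact: ltW.
  by rewrite subr_le0 ler_pdivlMr // -natrM ler_nat mulnC.
have LC0 : 0 < L%:R * C by apply: mulr_gt0.
set t := K%:R * (n.+1%:R ^+ L * expR (- (del * n%:R))) : R.
have t0 : 0 <= t by rewrite !mulr_ge0 ?expR_ge0 ?exprn_ge0.
have tQ : t * n.+1%:R <= Q.
  have -> : t * n.+1%:R = K%:R * (n.+1%:R ^+ L * n.+1%:R) / expR (del * n%:R).
    by rewrite /t expRN; ring.
  rewrite ler_pdivrMr ?expR_gt0 //; apply: le_trans (HQ n).
  rewrite -exprSr [leRHS]exprS; apply: ler_wpM2r; first exact: exprn_ge0.
  by rewrite ler_nat ltnW.
have tB : L%:R * C * t < B.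
  have n1 : 0 < n.+1%:R :> R by rewrite ltr0n.
  rewrite -(ltr_pM2r n1); apply: (@le_lt_trans _ _ (L%:R * C * Q)).
    by rewrite -[leLHS]mulrA; apply: ler_wpM2l tQ; exact: ltW.
  have Q0 : 0 <= L%:R * C * Q.
    by rewrite mulr_ge0 ?(ltW LC0) //; apply: le_trans tQ; rewrite mulr_ge0.
  have KQ' : 2 * (L%:R * C * Q) <= B * K%:R.
    rewrite -ler_pdivrMl //; apply: le_trans KQ.
    by rewrite le_eqVlt; apply/orP; left; apply/eqP; ring.
  have : B * K%:R < B * n.+1%:R by rewrite ltr_pM2l // ltr_nat ltnS.
  apply: le_lt_trans; apply: le_trans KQ'.
  by rewrite ler_peMl // ler1n.
apply: le_lt_trans (bound_le_shape K n) _; rewrite -/eb.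
apply: (@le_lt_trans _ _ (L%:R * C * t * eb)); last by rewrite ltr_pM2r.
rewrite /t -[L%:R * C * K%:R * _]mulrA; apply: ler_wpM2l; first by rewrite mulr_ge0 // ltW.
by rewrite ger_pMr.
Qed.

Let sum_box K : \sum_(i : 'I_L * 'I_K) (c * (K%:R - i.2%:R) + gam * K%:R) =
  L%:R * (c * (K%:R * (K%:R + 1) / 2) + gam * K%:R ^+ 2).
Proof.
rewrite -(pair_bigA _ (fun _ (j : 'I_K) => c * (K%:R - j%:R) + gam * K%:R)) /=.
rewrite sumr_const card_ord -[LHS]mulr_natl; congr (_ * _).
rewrite big_split /= -mulr_sumr sumrB !sumr_const card_ord sum_natr.
rewrite -[K%:R *+ K]mulr_natr -[(gam * K%:R) *+ K]mulr_natr.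
by field.
Qed.

Let sum_rows K : \sum_(n < L * K) ((c + gam) * (K%:R - n%:R / L%:R)) =
  (c + gam) * (K%:R * (L%:R * K%:R + 1) / 2).
Proof.
rewrite -mulr_sumr sumrB sumr_const card_ord -mulr_suml sum_natr.
rewrite -[K%:R *+ (L * K)]mulr_natr natrM.
by field; rewrite lt0r_neq0.
Qed.

Lemma integer_relation_of_growth : exists K (A : 'I_L * 'I_K -> int),
  (exists i, A i != 0) /\ forall n, combination (@column f L K) A n = 0.
Proof.
have [Q Q0 HQ] := poly_le_expR L.+2 del0.
have [Q2 Q20 HQ2] := poly_le_expR 2 (divr_gt0 gam0 (ltr0n _ 4)).
set G := 2 * (L%:R * C) / B * Q.
have G0 : 0 < G by rewrite !mulr_gt0 ?invr_gt0.
have [K HK] := exists_nat_ge (G + (G + 1) * Q2 + 3).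
have GQ2 : 0 < (G + 1) * Q2 by rewrite mulr_gt0 ?addr_gt0.
exists K; apply: (@integer_relation _ _ (@X K) D (L * K)).
- by move=> n; rewrite -(ltr_nat R); apply: lt_le_trans (D_ge n); rewrite mulr_gt0 ?expR_gt0.
- exact: D_dvd.
- rewrite -(ltr_nat R) !natr_prod.
  apply: (@lt_le_trans _ _ (\prod_(i : 'I_L * 'I_K)
      expR (c * (K%:R - i.2%:R) + gam * K%:R))); last first.
    by apply: ler_prod => i _; rewrite expR_ge0 X_gt.
  apply: (@le_lt_trans _ _ (\prod_(n < L * K) (expR (gam / 4 * K%:R) *
      expR ((c + gam) * (K%:R - n%:R / L%:R))))).
    apply: ler_prod => n _; rewrite ler0n /=.
    have HQL : n.+1%:R ^+ L <= Q * expR (del * n%:R).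
      by apply: le_trans (HQ n); rewrite ler_weXn2l ?ler1n // -addn2 leq_addr.
    apply: le_trans (row_count_le Q0 HQL (ltn_ord n)) _.
    rewrite ler_wpM2r ?expR_ge0 // -/G -(ler_pM2l Q20); apply: le_trans (HQ2 K).
    rewrite -natr1; apply: box_degree_arith => //.
    by apply: le_trans HK; rewrite -addrA addrCA lerDl addr_ge0 // ltW.
  under eq_bigr do rewrite -expRD.
  rewrite -!expR_sum ltr_expR sum_box big_split /= sum_rows.
  rewrite sumr_const card_ord -[X in X + _ < _]mulr_natl natrM.
  apply: box_exponent_arith; rewrite ?ler1n //.
  by apply: le_trans HK; rewrite lerDr addr_ge0 // ltW.
- move=> n; apply: row_small => //; rewrite -/G.
  by apply: le_trans HK; rewrite -addrA lerDl addr_ge0 // ltW.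
Qed.

End Relation.

(** * Combinations of shifts of a pseudo-polynomial *)
Lemma dvdz_prime_powers (P : set nat) (E : nat -> nat) (x : int) N :
  (P `<=` [set p | prime p]) ->
  (forall p, (p < N)%N -> P p -> ((p ^ E p)%:Z %| x)%Z) ->
  ((\prod_(0 <= p < N | p \in P) p ^ E p)%N%:Z %| x)%Z.
Proof.
move=> Pp; rewrite dvdzE /=; elim: N => [|N IH] H; first by rewrite big_nil dvd1n.
have {}IH := IH (fun p pN => H p (ltnW pN)).
rewrite big_mkcond big_nat_recr //= -big_mkcond /=.
case: ifP => [NP|_]; last by rewrite muln1.
rewrite Gauss_dvd ?IH /=; first by apply: (H N) => //; rewrite inE in NP.
rewrite coprimeXr // big_nat_cond.
elim/big_ind: _ => [|x1 x2 h1 h2|]; rewrite ?coprime1n ?coprimeMl ?h1 //.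
move=> p /andP[/andP[_ pN] pP]; rewrite coprimeXl //.
have Np := Pp _ (set_mem NP); have pp := Pp _ (set_mem pP).
by rewrite prime_coprime // dvdn_prime2 // ltn_eqF.
Qed.

Lemma combination_period f L K (A : 'I_L * 'I_K -> int) (p n : nat) :
  (forall n, (f (n + p)%N = f n %[mod p])%Z) ->
  (p %| combination (@column f L K) A (n + p) - combination (@column f L K) A n)%Z.
Proof.
move=> per; rewrite /combination -sumrB rpred_sum // => i _.
rewrite -mulrBr dvdz_mull // -eqz_mod_dvd /column.
rewrite -modzMm -modzXm PoszD modzDr modzXm.
by rewrite addnAC per modzMm.
Qed.

Lemma prime_prod_dvd P f L K (A : 'I_L * 'I_K -> int) m :
  (P `<=` [set p | prime p]) ->
  (forall p, P p -> forall n, (f (n + p)%N = f n %[mod p])%Z) ->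
  (forall i, (i < m)%N -> combination (@column f L K) A i = 0) ->
  ((prime_prod P m)%:Z %| combination (@column f L K) A m)%Z.
Proof.
move=> Pp per H; rewrite /prime_prod.
rewrite [X in Posz X](eq_bigr (fun p => p ^ 1)%N) => [|p _]; last by rewrite expn1.
apply: dvdz_prime_powers => // p; rewrite ltnS expn1 => pm pP.
have p0 : (0 < p)%N by exact/prime_gt0/Pp.
have := combination_period A (m - p) (per p pP).
by rewrite subnK // [X in _ - X]H ?subr0 //; lia.
Qed.

Lemma annihilatesXn f U W :
  (forall n, umbra f (U * 'X^n + W * ('X^n)^`()) = 0) -> annihilates f U W.
Proof.
move=> H q; rewrite -[q]coefK poly_def raddf_sum /= !mulr_sumr -big_split.
rewrite raddf_sum /= big1 // => i _.
rewrite derivZ -!mul_polyC mulrCA [W * _]mulrCA -mulrDr.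
by rewrite umbraCM H mulr0.
Qed.

Lemma umbra_poly f K (a : 'I_K -> int) n :
  umbra f ((\sum_j a j *: 'X^j) * 'X^n) = \sum_j a j * f (n + j)%N.
Proof.
rewrite mulr_suml raddf_sum /=; apply: eq_bigr => j _.
by rewrite -mul_polyC -mulrA umbraCM -exprD umbraXn addnC.
Qed.

Lemma poly_sum_neq0 K (a : 'I_K -> int) j : a j != 0 -> \sum_j a j *: 'X^j != 0 :> {poly int}.
Proof.
apply: contraNneq => /(congr1 (fun q : {poly int} => q`_j)); rewrite coef0 coef_sum.
rewrite (bigD1 j) //= coefZ coefXn eqxx mulr1 big1 ?addr0 => [/eqP //|i ij].
by rewrite coefZ coefXn val_eqE eq_sym (negPf ij) mulr0.
Qed.

Lemma combination_columnE f L K (A : 'I_L * 'I_K -> int) n : combination (@column f L K) A n =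
  \sum_k \sum_j A (k, j) * (n%:Z ^+ k * f (n + j)%N).
Proof. by rewrite /combination pair_bigA /=; apply: eq_bigr => -[]. Qed.

(** n f(n) is the value of [umbra f] at X (X^n)', so multiplication by n becomes
    the operator X d/dX. *)
Lemma first_order_relation f K (A : 'I_2 * 'I_K -> int) : (exists i, A i != 0) ->
  (forall n, combination (@column f 2 K) A n = 0) ->
  exists U V, annihilates f U ('X * V) /\ (U != 0) || (V != 0).
Proof.
move=> [[k j] Akj] H.
exists (\sum_j A (ord0, j) *: 'X^j), (\sum_j A (ord_max, j) *: 'X^j); split.
  apply: annihilatesXn => n.
  have -> : 'X * (\sum_j A (ord_max, j) *: 'X^j) * ('X^n)^`() =
     n%:Z%:P * ((\sum_j A (ord_max, j) *: 'X^j) * 'X^n) :> {poly int}.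
    rewrite derivXn mulrAC [RHS]mulrCA [RHS]mulrC; congr (_ * _).
    case: n => [|n]; first by rewrite mulr0n mulr0 mul0r.
    by rewrite mulrnAr -exprS -mulr_natl -natz polyC_natr.
  rewrite raddfD /= umbraCM !umbra_poly -[RHS](H n) combination_columnE.
  rewrite big_ord_recl big_ord1 mulr_sumr.
  congr (_ + _); apply: eq_bigr => i _; first by rewrite expr0 mul1r.
  by rewrite expr1 mulrCA; congr (A (_, i) * _); apply: val_inj.
have [k0|k1] : k = ord0 \/ k = ord_max.
  by case: k {Akj} => [[|[|//]] hk]; [left|right]; apply: val_inj.
- by apply/orP; left; apply: poly_sum_neq0 (j) _; rewrite -k0.
- by apply/orP; right; apply: poly_sum_neq0 (j) _; rewrite -k1.
Qed.

Lemma combination_umbra f K (A : 'I_1 * 'I_K -> int) :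
  exists chi, (forall n, combination (@column f 1 K) A n = umbra f (chi * 'X^n)) /\
    ((exists i, A i != 0) -> chi != 0).
Proof.
exists (\sum_j A (ord0, j) *: 'X^j); split => [n|[[k j] Akj]].
  rewrite umbra_poly combination_columnE big_ord1.
  by apply: eq_bigr => j _; rewrite expr0 mul1r.
by apply: poly_sum_neq0 (j) _; rewrite -(ord1 k : k = ord0).
Qed.

(** * Superexponential products of prime powers *)
Lemma harmonic_sum_unbounded (R : realType) (x : R) :
  exists t, x <= \sum_(k < t) (k.+1%:R)^-1.
Proof.
apply: contrapT => H; apply: (@dvg_harmonic R); apply: nondecreasing_is_cvgn.
  apply/nondecreasing_seqP => n.
  by rewrite /series /= big_nat_recr //= lerDl ltW ?harmonic_gt0.
exists x => _ [n _ <-]; apply/ltW; rewrite ltNge; apply/negP => h; apply: H.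
by exists n; move: h; rewrite /series /= big_mkord.
Qed.

Lemma sum_ltn t X : (\sum_(k < t) (k < X)%N = minn t X)%N.
Proof.
elim: t => [|t IH]; first by rewrite big_ord0 min0n.
by rewrite big_ord_recr /= IH; case: (ltnP t X) => /= ?; lia.
Qed.

Definition primes_above (P : set nat) (N : nat) : set nat :=
  [set p | P p /\ (N < p)%N].

Lemma prime_prod_above P N j :
  (prime_prod P j <= prime_prod (primes_above P N) j * N.+1 ^ N.+1)%N.
Proof.
suff H : (prime_prod P j <= prime_prod (primes_above P N) j * N.+1 ^ minn j.+1 N.+1)%N.
  apply: leq_trans H _; rewrite leq_mul2l leq_pexp2l ?orbT //; exact: geq_minr.
rewrite /prime_prod; elim: j.+1 => [|i IH]; first by rewrite !big_nil min0n.
rewrite big_mkcond big_nat_recr //= -big_mkcond /=.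
rewrite [X in (_ <= X * _)%N]big_mkcond [X in (_ <= X * _)%N]big_nat_recr //= -big_mkcond /=.
have [iN|Ni] := leqP i N.
  move: IH; rewrite minnSS (minn_idPl iN) (minn_idPl (leqW iN)) => IH.
  have hP : ((if i \in P then i else 1) <= N.+1)%N by case: ifP => // _; apply: ltnW.
  apply: leq_trans (leq_mul IH hP) _; rewrite expnSr mulnA leq_mul2r; apply/orP; right.
  by rewrite leq_mul2r leq_pmulr ?orbT //; case: ifP => // /set_mem[_]; apply: leq_ltn_trans.
move: IH; rewrite minnSS (minn_idPr Ni) (minn_idPr (ltnW Ni)) => IH.
have -> : (i \in primes_above P N) = (i \in P).
  by apply/idP/idP => /set_mem h; apply/mem_set; [case: h | split].
by rewrite mulnAC leq_mul2r IH orbT.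
Qed.

Definition prime_powers (P : set nat) e m : nat :=
  (\prod_(0 <= p < m.+1 | p \in P) p ^ (m %/ (p * e)))%N.

(** The exponent m / (pe) counts the k >= 1 with p <= m / (ek). *)
Lemma prime_prods_le_powers P e m t : (0 < e)%N ->
  (P `<=` [set p | prime p]) ->
  (\prod_(k < t) prime_prod P (m %/ (e * k.+1)) <= prime_powers P e m)%N.
Proof.
move=> e0 Pp.
have widen k : prime_prod P (m %/ (e * k.+1)) =
    (\prod_(0 <= p < m.+1 | p \in P) p ^ (k < m %/ (p * e)))%N.
  rewrite /prime_prod (@big_nat_widen _ _ _ _ _ m.+1) ?ltnS ?leq_div //.
  rewrite big_mkcondr /=; apply: eq_bigr => p /set_mem/Pp/= pp.
  have p0 := prime_gt0 pp.
  rewrite ltnS leq_divRL ?muln_gt0 ?e0 // leq_divRL ?muln_gt0 ?e0 ?p0 //.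
  have -> : (p * (e * k.+1) = k.+1 * (p * e))%N by ring.
  by case: leqP; rewrite ?expn1 ?expn0.
rewrite (eq_bigr _ (fun k _ => widen (val k))) exchange_big /=.
rewrite /prime_powers.
elim/big_ind2: _ => // [x1 x2 y1 y2|p /set_mem/Pp/= pp]; first exact: leq_mul.
by rewrite -expn_sum sum_ltn leq_pexp2l ?prime_gt0 // geq_minr.
Qed.

(** The product of the primes up to m / (ek) is at least about e^(am/(ek)); the sum
    over k < t of the exponents is (am/e) times a harmonic sum, and t is free. *)
Lemma prime_powers_superexponential (R : realType) (a B : R) P e N (b : R) :
  0 < a -> 0 < B -> (0 < e)%N ->
  (P `<=` [set p | prime p]) ->
  (forall j, B * expR (a * j%:R) <= (prime_prod P j)%:R) ->
  exists2 B' : R, 0 < B' &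
    forall m, B' * expR (b * m%:R) <= (prime_powers (primes_above P N) e m)%:R.
Proof.
move=> a0 B0 e0 Pp low.
have e0R : 0 < e%:R :> R by rewrite ltr0n.
pose B1 := B / (N.+1 ^ N.+1)%:R.
have B10 : 0 < B1 by rewrite divr_gt0 // ltr0n expn_gt0.
have lowt j : B1 * expR (a * j%:R) <= (prime_prod (primes_above P N) j)%:R.
  rewrite /B1 mulrAC ler_pdivrMr ?ltr0n ?expn_gt0 //.
  by apply: le_trans (low j) _; rewrite -natrM ler_nat prime_prod_above.
clearbody B1.
have [t Ht] := harmonic_sum_unbounded (b * e%:R / a).
exists ((B1 * expR (- a)) ^+ t) => [|m]; first by rewrite exprn_gt0 // mulr_gt0 ?expR_gt0.
have tail_prime : (primes_above P N `<=` [set p | prime p]) by move=> p [/Pp].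
apply: le_trans (_ : (\prod_(k < t) prime_prod (primes_above P N)
    (m %/ (e * k.+1)))%N%:R <= _); last first.
  by rewrite ler_nat prime_prods_le_powers.
apply: (@le_trans _ _ (\prod_(k < t) ((B1 * expR (- a)) * expR (a * m%:R / e%:R / k.+1%:R)))).
  rewrite big_split /= prodr_const card_ord.
  rewrite ler_wpM2l ?exprn_ge0 ?mulr_ge0 ?expR_ge0 ?(ltW B10) //.
  rewrite -expR_sum ler_expR -mulr_sumr.
  have -> : b * m%:R = a * m%:R / e%:R * (b * e%:R / a).
    by field; rewrite !lt0r_neq0.
  by rewrite ler_wpM2l // !mulr_ge0 ?invr_ge0 // ltW.
rewrite natr_prod; apply: ler_prod => k _; rewrite !mulr_ge0 ?expR_ge0 ?(ltW B10) //=.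
apply: le_trans (lowt _); rewrite -mulrA ler_wpM2l ?(ltW B10) // -expRD ler_expR.
set d := (e * k.+1)%N; have d0 : (0 < d)%N by rewrite muln_gt0 e0.
have -> : - a + a * m%:R / e%:R / k.+1%:R = a * (m%:R / d%:R - 1).
  by rewrite /d natrM; field; rewrite nat1r !pnatr_eq0 /= -lt0n.
apply: ler_wpM2l; first exact: ltW.
rewrite lerBlDr ler_pdivrMr ?ltr0n // natr1 -natrM ler_nat.
by apply/ltnW/ltn_ceil.
Qed.

(** * From a first order relation to a polynomial *)
Definition finite_newton (f : nat -> int) :=
  exists e, forall m, (e <= m)%N -> umbra f (('X - 1) ^+ m) = 0.

Lemma finite_newton_delta f : finite_newton (delta f) -> finite_newton f.
Proof.
move=> [e He]; exists e.+1 => -[//|m em].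
by rewrite exprS -umbra_delta He.
Qed.

Lemma finite_newton_dvd f e (Q : nat -> Prop) :
  (forall N, exists p, Q p /\ (N < p)%N) ->
  (forall p, Q p -> forall m, (e <= m)%N -> (p%:Z %| umbra f (('X - 1) ^+ m))%Z) ->
  finite_newton f.
Proof.
move=> Qinf H; exists e => m em.
have [p [Qp pm]] := Qinf `|umbra f (('X - 1) ^+ m)|%N.
exact: dvdz_small (H p Qp m em) pm.
Qed.

Lemma finite_newton_poly f : finite_newton f ->
  exists P : {poly rat}, forall n : nat, (f n)%:~R = P.[n%:R].
Proof.
move=> [e He]; pose a i : int := umbra f (('X - 1) ^+ i).
exists (\sum_(i < e) ((a i)%:~R / (i`!)%:R) *: \prod_(k < i) ('X - k%:R%:P)) => n.
have -> : f n = \sum_(i < e) a i *+ 'C(n, i).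
  pose F i := a i *+ 'C(n, i).
  have truncate k m : (k <= m)%N -> (forall i, (k <= i)%N -> F i = 0) ->
      \sum_(i < m) F i = \sum_(i < k) F i.
    move=> km F0; rewrite [RHS](big_ord_widen m F km) [RHS]big_mkcond.
    by apply: eq_bigr => i _; case: ltnP => // /F0.
  rewrite -(truncate e (maxn e n.+1)) ?leq_maxl //; last first.
    by move=> i /He; rewrite /F /a => ->; rewrite mul0rn.
  rewrite (truncate n.+1) ?leq_maxr //; last first.
    by move=> i ni; rewrite /F bin_small ?mulr0n.
  rewrite -(umbraXn f n) -['X](subrK 1) exprDn raddf_sum /=.
  rewrite (reindex_inj rev_ord_inj) /=; apply: eq_bigr => i _.
  have in' : (i <= n)%N by rewrite -ltnS.
  by rewrite subSS subKn // expr1n mulr1 raddfMn bin_sub.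
rewrite raddf_sum horner_sum /=; apply: eq_bigr => i _.
rewrite hornerZ horner_prod raddfMn /=.
have -> : \prod_(k < i) ('X - k%:R%:P).[n%:R] = (n ^_ i)%:R :> rat.
  elim: (val i) => [|m IH]; first by rewrite big_ord0 ffactn0.
  rewrite big_ord_recr /= IH hornerXsubC ffactnSr.
  have [mn|nm] := leqP m n; first by rewrite natrM natrB.
  by rewrite ffact_small // !mul0r mul0n.
by rewrite -bin_ffact natrM mulrCA divfK ?pnatr_eq0 -?lt0n ?fact_gt0 // mulr_natl.
Qed.

Section Main.
Variables (R : realType) (a B : R) (P : set nat).
Hypotheses (a0 : 0 < a) (B0 : 0 < B) (Pprime : P `<=` [set p | prime p]).
Hypothesis prime_prod_ge : forall j, B * expR (a * j%:R) <= (prime_prod P j)%:R.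

Definition periodic_mod (f : nat -> int) :=
  forall p, P p -> forall n : nat, (f (n + p)%N = f n %[mod p])%Z.

Lemma unbounded_primes N : exists p, P p /\ (N < p)%N.
Proof.
apply: contrapT => H.
have no_large_prime j : prime_prod (primes_above P N) j = 1%N.
  by rewrite /prime_prod big1 // => p /set_mem[pP Np]; case: H; exists p.
have [j Hj] := exists_nat_ge ((N.+1 ^ N.+1)%:R / B / a).
have := prime_prod_ge j; apply/negP; rewrite -ltNge.
apply: (@le_lt_trans _ _ (N.+1 ^ N.+1)%:R).
  rewrite ler_nat; apply: leq_trans (prime_prod_above P N j) _.
  by rewrite no_large_prime mul1n.
rewrite -ltr_pdivrMl // mulrC; apply: lt_le_trans (expR_ge1Dx _).
by rewrite ler_pdivrMr // mulrC in Hj; lra.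
Qed.

(** Write chi = chi1 t^h with chi1(1) <> 0.  If d >= h is the last exponent whose
    difference is prime to [p], then chi1(1) times it vanishes modulo [p], which is
    impossible for p > |chi1(1)|. *)
Lemma recurrent_finite_newton f chi : periodic_mod f -> chi != 0 ->
  (forall q, umbra f (chi * q) = 0) -> finite_newton f.
Proof.
move=> per chi0 rel; have [h [chi1]] := multiplicity_XsubC chi 1.
rewrite chi0 /= rootE => chi1_1 chiE.
apply: (@finite_newton_dvd f h (fun p => P p /\ (`|chi1.[1%R]| < p)%N)) => [N|p [pP p_big]].
  have [p [pP Np]] := unbounded_primes (maxn N `|chi1.[1%R]|).
  by exists p; move: Np; rewrite gtn_max => /andP[].
have pp : prime p := Pprime pP.
apply: (umbra_descent pp (per p pP)) => d hd tl.
apply: (@prime_dvdzM p _ chi1.[1]); first exact: pp.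
  by apply: contra chi1_1 => /dvdz_small -> //.
have key : umbra f (('X - 1) ^+ d * chi1) = 0.
  rewrite -{1}(subnK hd) exprD -mulrA mulrC -[RHS](rel (('X - 1) ^+ (d - h))) chiE polyC1.
  by congr umbra; ring.
by have := umbra_head chi1 tl; rewrite key sub0r rpredN mulrC.
Qed.

(** The p-curvature vanishes either for infinitely many p in P, or for none beyond
    some N; in the second case the rate 2c + 1 exceeds the threshold 2c of L = 1. *)
Lemma normalized_finite_newton f (c C : R) U W1 : periodic_mod f ->
  0 < c -> 0 < C -> (forall n, (`|f n|%N)%:R <= C * expR (c * n%:R)) ->
  annihilates f U (('X - 1) * W1) -> (U.[1] != 0) || (W1.[1] != 0) -> finite_newton f.
Proof.
move=> per c0 C0 f_le rel nz; pose W := ('X - 1) * W1.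
have [zero|] := pselect (forall N, exists p,
    (P p /\ redp p (twists U W p 1) = 0) /\ (N < p)%N).
  apply: (@finite_newton_dvd f `|U.[1%R]|.+1
    (fun p => (P p /\ redp p (twists U W p 1) = 0) /\ (`|U.[1%R]| + `|W1.[1%R]| < p)%N)).
    move=> N; have [p [pP Np]] := zero (maxn N (`|U.[1%R]| + `|W1.[1%R]|)).
    by exists p; move: Np; rewrite gtn_max => /andP[].
  move=> p [[pP psi0] p_big] m Um.
  have pp : prime p := Pprime pP.
  exact: (zero_curvature pp (per p pP) rel nz p_big psi0 Um).
move=> /existsNP[N HN].
have psi p : P p -> (N < p)%N -> redp p (twists U W p 1) != 0.
  by move=> pP Np; apply: contra_notN HN => /eqP psi0; exists p.
pose e := maxn (size U) (size W).+1.
have e0 : (0 < e)%N by rewrite /e leq_max orbT.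
have [B' B'0 HB'] := prime_powers_superexponential N (2 * c + 1) a0 B0 e0 Pprime prime_prod_ge.
have tail_prime : primes_above P N `<=` [set p | prime p] by move=> p [/Pprime].
have [||K [A [A0 HA]]] := @integer_relation_of_growth R c (2 * c + 1) C B' 1 f
    (prime_powers (primes_above P N) e) c0 C0 B'0 isT _ f_le HB'.
- by rewrite mulr1; lra.
- move=> K A m HA; have [chi [chiE _]] := combination_umbra f A.
  apply: dvdz_prime_powers => // p _ [pP Np]; rewrite chiE.
  have pp : prime p := Pprime pP.
  apply: (annihilator_dvd pp rel _ _ (psi p pP Np)).
  + by rewrite leqW // /e leq_max leqnn.
  + by rewrite leqW // /e leq_max leqnSn orbT.
  + by move=> i im; rewrite -chiE HA.
have [chi [chiE chi0]] := combination_umbra f A.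
apply: (@recurrent_finite_newton f chi) => //; first exact: chi0.
move=> q; apply: (@umbra_lowdeg f chi q (size q)) => // i _.
by rewrite -chiE HA.
Qed.

(** Common factors t of U and W1 are removed by passing to the difference of [f],
    which keeps the periods and the growth rate [c]. *)
Lemma first_order_finite_newton f (c C : R) U W1 : periodic_mod f ->
  0 < c -> 0 < C -> (forall n, (`|f n|%N)%:R <= C * expR (c * n%:R)) ->
  annihilates f U (('X - 1) * W1) -> (U != 0) || (W1 != 0) -> finite_newton f.
Proof.
have [n] := ubnP (size U + size W1); elim: n f C U W1 => // n IH f C U W1.
rewrite ltnS => hn per c0 C0 f_le rel nz.
have [nz1|] := boolP ((U.[1] != 0) || (W1.[1] != 0)).
  exact: normalized_finite_newton per c0 C0 f_le rel nz1.
rewrite negb_or !negbK => /andP[/eqP U1 /eqP W11]; apply: finite_newton_delta.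
have [U' HU] := polyXsub1_div U; have [W1' HW] := polyXsub1_div W1.
rewrite U1 polyC0 add0r in HU; rewrite W11 polyC0 add0r in HW.
have sizeM (q : {poly int}) : q != 0 -> (size q < size (('X - 1) * q)%R)%N.
  by move=> q0; rewrite -polyC1 mulrC size_Mmonic ?monicXsubC // size_XsubC addn2.
have sizeMle (q : {poly int}) : (size q <= size (('X - 1) * q)%R)%N.
  have [->|q0] := eqVneq q 0; first by rewrite size_poly0.
  exact/ltnW/sizeM.
have nz' : (U' != 0) || (W1' != 0).
  by move: nz; rewrite HU HW !mulf_eq0 -polyC1 polyXsubC_eq0.
apply: (IH (delta f) (C * (expR c + 1)) U' W1') => //.
- apply: leq_trans hn; rewrite HU HW; case/orP: nz' => q0.
    by rewrite -addSn leq_add ?sizeM.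
  by rewrite -addnS leq_add ?sizeM.
- move=> p pP m; apply/eqP; rewrite eqz_mod_dvd /delta -addSn.
  have -> : f (m.+1 + p)%N - f (m + p)%N - (f m.+1 - f m) =
      (f (m.+1 + p)%N - f m.+1) - (f (m + p)%N - f m) by ring.
  by rewrite rpredB // -eqz_mod_dvd; apply/eqP/per.
- by rewrite mulr_gt0 // addr_gt0 // expR_gt0.
- move=> m; have tri (x y : int) : (`|(x - y)%R| <= `|x| + `|y|)%N by lia.
  apply: (@le_trans _ _ (`|f m.+1|%N%:R + `|f m|%N%:R)).
    by rewrite -natrD ler_nat; apply: tri.
  apply: le_trans (lerD (f_le _) (f_le _)) _.
  by rewrite -natr1 mulrDr mulr1 expRD le_eqVlt; apply/orP; left; apply/eqP; ring.
- move=> q; rewrite umbra_delta -[RHS](rel q) HU HW; congr umbra; ring.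
Qed.

End Main.

(** * Asymptotic hypotheses as uniform bounds *)
Lemma prime_prod_lower (R : realType) (alpha b : R) (P : set nat) :
  0 < b -> b < alpha -> prod_asymptotic alpha P ->
  exists2 B : R, 0 < B & forall j, B * expR (b * j%:R) <= (prime_prod P j)%:R.
Proof.
move=> b0 ba [u [/eqoP uo Hu]].
have ba0 : 0 < alpha - b by rewrite subr_gt0.
have [j0 _ Hj0] := uo _ ba0.
exists (expR (- (b * j0%:R))) => [|j]; first exact: expR_gt0.
rewrite -expRD; have [jj|jj] := leqP j0 j.
  rewrite Hu ler_expR.
  have := Hj0 j jj; rewrite /= [`|j%:R|]ger0_norm // => hu.
  have := ler_norm (- u j); rewrite normrN => hu'.
  have : 0 <= b * j0%:R by rewrite mulr_ge0 // ltW.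
  by rewrite mulrBl in hu; lra.
apply: (@le_trans _ _ 1).
  rewrite -[leRHS]expR0 ler_expR addrC subr_le0.
  by apply: ler_wpM2l; [exact: ltW | rewrite ler_nat ltnW].
by rewrite ler1n -(ltr_nat R) Hu expR_gt0.
Qed.

Lemma growth_bound (R : realType) (c c' : R) (f : nat -> int) :
  0 < c -> c' <= c ->
  (fun n : nat => (f n)%:~R : R) =O_\oo (fun n : nat => expR (c' * n%:R)) ->
  exists2 C : R, 0 < C & forall n, (`|f n|%N)%:R <= C * expR (c * n%:R).
Proof.
move=> c0 cc' /eqO_exP[k k0 [n0 _ Hn0]].
exists (k + \sum_(i < n0) (`|f i|%N)%:R) => [|n]; first by rewrite ltr_pwDl // sumr_ge0.
have S0 : 0 <= \sum_(i < n0) (`|f i|%N)%:R :> R by rewrite sumr_ge0.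
have [nn|nn] := leqP n0 n.
  have := Hn0 n nn; rewrite /= (ger0_norm (expR_ge0 _)) -intr_norm -natr_absz => h.
  apply: le_trans h _; apply: ler_pM; rewrite ?expR_ge0 ?(ltW k0) ?lerDl //.
  by rewrite ler_expR ler_wpM2r.
have e1 : 1 <= expR (c * n%:R).
  by apply: le_trans (expR_ge1Dx _); rewrite lerDl mulr_ge0 // ltW.
rewrite -[leLHS]mulr1; apply: ler_pM => //.
rewrite (bigD1 (Ordinal nn)) //= addrCA lerDl addr_ge0 ?(ltW k0) //.
by rewrite sumr_ge0.
Qed.

Theorem theorem1p8 (R : realType) (alpha epsilon : R)
    (halpha0 : 0 < alpha) (halpha1 : alpha <= 1) (hepsilon : 0 < epsilon)
    (f : nat -> int)
    (hf : primary_pseudo_polynomial alpha f)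
    (hgrowth : (fun n : nat => (f n)%:~R : R) =O_\oo
               (fun n : nat => expR ((2 / 3 - epsilon) * alpha * n%:R))) :
  exists P : {poly rat}, forall n : nat, (f n)%:~R = P.[n%:R].
Proof.
case: hf => P [Pprime Pasym per].
(* Any 0 < d < 2/3 with d <= epsilon serves: then c = (2/3 - d) alpha is positive, and
   b = (1 - d) alpha lies strictly between 3c/2 and alpha. *)
pose d := Num.min epsilon (1 / 3).
have d0 : 0 < d by rewrite /d lt_min hepsilon; lra.
have d13 : d <= 1 / 3 by rewrite /d ge_min lexx orbT.
have de : d <= epsilon by rewrite /d ge_min lexx.
pose c := (2 / 3 - d) * alpha; pose b := (1 - d) * alpha.
have c0 : 0 < c by rewrite mulr_gt0 //; lra.
have b0 : 0 < b by rewrite mulr_gt0 //; lra.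
have ba : b < alpha by rewrite /b gtr_pMl //; lra.
have cb : c * 3 < b * 2.
  have -> : c * 3 = (2 - 3 * d) * alpha by rewrite /c; field.
  have -> : b * 2 = (2 - 2 * d) * alpha by rewrite /b; ring.
  by rewrite ltr_pM2r //; lra.
have [B B0 prime_prod_ge] := prime_prod_lower b0 ba Pasym.
have cc' : (2 / 3 - epsilon) * alpha <= c by rewrite ler_pM2r //; lra.
have [C C0 f_le] := growth_bound c0 cc' hgrowth.
have [K [A [A0 HA]]] := integer_relation_of_growth c0 C0 B0 (isT : (0 < 2)%N) cb f_le
  prime_prod_ge
  (fun K A m => @prime_prod_dvd P f 2 K A m Pprime per).
have [U [V [rel nz]]] := first_order_relation A0 HA.
apply: finite_newton_poly.
apply: (first_order_finite_newton b0 B0 Pprime prime_prod_ge per c0 C0 f_le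
  (U := ('X - 1) * U + 'X * V) (W1 := 'X * V)).
  (* This is the relation for t q, so that W = t X V vanishes at 1. *)
  move=> q; rewrite -[RHS](rel (('X - 1) * q)) derivM derivB derivX derivC subr0 mul1r.
  by congr umbra; ring.
have [V0|V0] := eqVneq V 0; last by rewrite mulf_neq0 ?polyX_eq0 ?orbT.
move: nz; rewrite V0 eqxx orbF => U0.
by rewrite mulr0 addr0 mulf_neq0 // -polyC1 polyXsubC_eq0.
Qed.
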